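(* Let $A$ be an associative Banach $D$-algebra with unit, $a=(a^i_j)$ an $n\times n$ matrix with entries in $A$, and let $b\in A$ be a ${}_*{}^*$-eigenvalue of the matrix $a$. Suppose that the entries of $a$ do not satisfy the condition $a^i_j\in A[b]$ for all $i,j=1,\dots,n$. If the entries of a ${}_*{}^*$-eigencolumn $c=(c^1,\dots,c^n)^T$ of $a$ corresponding to $b$ satisfy $$c^i\in A[b],\qquad i=1,\dots,n,$$ then the column of maps $$x(t)=e^{bt}c=(e^{bt}c^1,\dots,e^{bt}c^n)^T,\qquad t\in\mathbb{R},$$ is a solution of the system of differential equations $$\frac{dx^i}{dt}=\sum_{k=1}^na^i_kx^k,\qquad i=1,\dots,n.$$
   Context: $D$ is a complete commutative (normed) ring of characteristic $0$; real scalars act on $A$. $A[b]=\{c\in A: cb=bc\}$. $e^{y}=\sum_{n\ge0}\frac1{n!}y^n$. The ${}_*{}^*$-product of matrices is $(p_*{}^*q)^i_j=\sum_kp^i_kq^k_j$ (upper index = row, lower index = column); $E$ is the unit matrix. $b\in A$ is a ${}_*{}^*$-eigenvalue of $a$ if the matrix $a-bE$ is ${}_*{}^*$-singular (has no inverse for the ${}_*{}^*$-product). A column $c$ is a ${}_*{}^*$-eigencolumn of $a$ corresponding to $b$ if $a_*{}^*c=bc$, i.e. $\sum_ka^i_kc^k=bc^i$ for all $i$. The unknowns $x^i:\mathbb{R}\to A$ are $A$-valued functions of a real variable. *)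

(* Defs.v *)
(* MathComp-Analysis; R : realType plays the role of the real numbers. *)
From HB Require Import structures.
From mathcomp Require Import all_boot all_order all_algebra.
From mathcomp Require Import all_classical all_reals all_analysis.
Set Implicit Arguments.
Unset Strict Implicit.
Unset Printing Implicit Defensive.
Import Order.TTheory GRing.Theory Num.Theory.
Import numFieldNormedType.Exports.
Local Open Scope classical_set_scope.
Local Open Scope ring_scope.

(* The hierarchy has no structure joining rings and normed modules, and one
   cannot be added outside of the library ([numDomainType] already joins rings
   and norms). The normed rings below are therefore plain records whose carriers
   receive the ring and the normed structures as separate canonical instances
   over the same additive group. *)
Record completeNormedComRing (R : realType) := CompleteNormedComRing {
  cnr_space : pseudoMetricNormedZmodType R;
  cnr_one : cnr_space;
  cnr_mul : cnr_space -> cnr_space -> cnr_space;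
  cnr_mulA : associative cnr_mul;
  cnr_mulC : commutative cnr_mul;
  cnr_mul1 : left_id cnr_one cnr_mul;
  cnr_mulD : left_distributive cnr_mul +%R;
  cnr_one_neq0 : cnr_one != 0;
  cnr_norm_mul : forall x y, `|cnr_mul x y| <= `|x| * `|y|;
  cnr_complete : forall F : set_system cnr_space,
    ProperFilter F -> cauchy F -> cvg F
}.

Definition cnr_carrier (R : realType) (D : completeNormedComRing R) : Type :=
  cnr_space D.
Coercion cnr_carrier : completeNormedComRing >-> Sortclass.

HB.instance Definition _ (R : realType) (D : completeNormedComRing R) :=
  PseudoMetricNormedZmod.copy (cnr_carrier D) (cnr_space D).
HB.instance Definition _ (R : realType) (D : completeNormedComRing R) :=
  GRing.Zmodule_isComNzRing.Build (cnr_carrier D)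
    (@cnr_mulA R D) (@cnr_mulC R D) (@cnr_mul1 R D) (@cnr_mulD R D)
    (@cnr_one_neq0 R D).

Record realBanachAlg (R : realType) := RealBanachAlg {
  rba_space : completeNormedModType R;
  rba_one : rba_space;
  rba_mul : rba_space -> rba_space -> rba_space;
  rba_mulA : associative rba_mul;
  rba_mul1x : left_id rba_one rba_mul;
  rba_mulx1 : right_id rba_one rba_mul;
  rba_mulDl : left_distributive rba_mul +%R;
  rba_mulDr : right_distributive rba_mul +%R;
  rba_one_neq0 : rba_one != 0;
  rba_scaleAl : forall (r : R) x y, r *: rba_mul x y = rba_mul (r *: x) y;
  rba_scaleAr : forall (r : R) x y, r *: rba_mul x y = rba_mul x (r *: y);
  rba_norm_mul : forall x y, `|rba_mul x y| <= `|x| * `|y|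
}.

Definition rba_carrier (R : realType) (A : realBanachAlg R) : Type :=
  rba_space A.
Coercion rba_carrier : realBanachAlg >-> Sortclass.

HB.instance Definition _ (R : realType) (A : realBanachAlg R) :=
  CompleteNormedModule.copy (rba_carrier A) (rba_space A).
HB.instance Definition _ (R : realType) (A : realBanachAlg R) :=
  GRing.Zmodule_isNzRing.Build (rba_carrier A)
    (@rba_mulA R A) (@rba_mul1x R A) (@rba_mulx1 R A) (@rba_mulDl R A)
    (@rba_mulDr R A) (@rba_one_neq0 R A).
HB.instance Definition _ (R : realType) (A : realBanachAlg R) :=
  GRing.Lmodule_isLalgebra.Build R (rba_carrier A) (@rba_scaleAl R A).
HB.instance Definition _ (R : realType) (A : realBanachAlg R) :=
  GRing.Lalgebra_isAlgebra.Build R (rba_carrier A) (@rba_scaleAr R A).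

(* A type carries at most one canonical [lmodType] structure. On A it is the
   one given by the real scalars, on which limits and derivatives depend; the
   action of D is therefore a separate operation [dact]. It commutes with the
   real scalars because both actions are central: d (r x) = (d 1) (r 1) x. *)
Record banachAlg (R : realType) (D : completeNormedComRing R) := BanachAlg {
  ba_real :> realBanachAlg R;
  dact : D -> ba_real -> ba_real;
  dactA : forall (d e : D) x, dact d (dact e x) = dact (d * e) x;
  dact1 : forall x, dact 1 x = x;
  dactDr : forall (d : D) x y, dact d (x + y) = dact d x + dact d y;
  dactDl : forall (d e : D) x, dact (d + e) x = dact d x + dact e x;
  dactAl : forall (d : D) x y, dact d (x * y) = dact d x * y;
  dactAr : forall (d : D) x y, dact d (x * y) = x * dact d y;
  norm_dact_le : forall (d : D) x, `|dact d x| <= `|d| * `|x|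
}.

(* [pchar D] =i pred0 would not do: it holds in Z/4Z, since it only excludes
   prime characteristics. *)
Definition ring_characteristic0 (D : nzRingType) : Prop :=
  injective (fun m : nat => m%:R : D).

Definition centralizer (A : nzRingType) (b : A) : set A :=
  [set c | c * b = b * c].

(* The product in which the rows of the left factor meet the columns of the
   right one is the matrix product [*m]. *)
Definition rc_singular (A : nzRingType) n (m : 'M[A]_n) : Prop :=
  ~ exists m' : 'M[A]_n, m *m m' = 1%:M /\ m' *m m = 1%:M.

Definition rc_eigenvalue (A : nzRingType) n (a : 'M[A]_n) (b : A) : Prop :=
  rc_singular (a - b%:M).

Definition rc_eigencolumn (A : nzRingType) n (a : 'M[A]_n) (b : A)
    (c : 'cV[A]_n) : Prop :=
  a *m c = b *: c.

(* Not the real function [expR] but its analogue in A. *)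
Definition expA (R : realType) (A : realBanachAlg R) (y : A) : A :=
  limn (series (fun k : nat => (k`!%:R^-1 : R) *: y ^+ k)).

Definition linear_ode_solution (R : realType) (A : realBanachAlg R) n
    (a : 'M[A]_n) (x : R -> 'cV[A]_n) : Prop :=
  forall (i : 'I_n) (t : R),
    is_derive t 1 (fun s => x s i 0) (\sum_(k < n) a i k * x t k 0).

(* Main.v *)
(** Since c^i commutes with b it commutes with e^{bt}, hence
    sum_k a^i_k e^{bt} c^k = (sum_k a^i_k c^k) e^{bt} = b c^i e^{bt}
    = b e^{bt} c^i, and it remains to see that b e^{bt} is the derivative of
    e^{bt}. This does not need the addition formula: the real estimate
    |s^{k+1} - t^{k+1} - (s - t)(k+1) t^k| <= k (k+1) M^k (s - t)^2, valid for
    |s|, |t| <= M and M >= 1, bounds every term of the series of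
    e^{bs} - e^{bt} - (s - t) b e^{bt}, and summing up bounds that element
    by a constant times (s - t)^2. *)
Require Import Defs.
From HB Require Import structures.
From mathcomp Require Import all_boot all_order all_algebra.
From mathcomp Require Import all_classical all_reals all_analysis.
From mathcomp Require Import ring.
Set Implicit Arguments.
Unset Strict Implicit.
Unset Printing Implicit Defensive.
Import Order.TTheory GRing.Theory Num.Theory.
Import numFieldNormedType.Exports.
Local Open Scope classical_set_scope.
Local Open Scope ring_scope.

(** Dividing the hypothesis by |h| bounds the error of the difference quotient by C |h|. Asking for
    it only when |h| <= 1 leaves room for a [C] that depends on [t]. *)
Lemma is_derive1_quadratic (R : realType) (V : normedModType R) (f : R -> V)
    (t : R) (d : V) (C : R) :
  (forall h, `|h| <= 1 -> `|f (t + h) - f t - h *: d| <= C * h ^+ 2) ->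
  is_derive t 1 f d.
Proof.
move=> fP.
suff fD : (h^-1 *: ((f \o shift t) (h *: (1 : R)) - f t)) @[h --> 0^'] --> d.
  by split; [apply/cvg_ex; exists d | exact: cvg_lim fD].
have C_ge0 : 0 <= C.
  by have := fP 1; rewrite normr1 expr1n mulr1 => /(_ (lexx _)); apply: le_trans.
apply/cvgrPdist_le => e e_gt0; near=> h.
have h_neq0 : h != 0 by near: h; exact: nbhs_dnbhs_neq.
have h_le1 : `|h| <= 1.
  by near: h; apply: dnbhs0_le.
(* The added 1 keeps the divisor positive when [C] is 0. *)
have h_lee : `|h| <= e / (C + 1).
  by near: h; apply: dnbhs0_le; rewrite divr_gt0// ltr_wpDl.
have -> : d - h^-1 *: ((f \o shift t) (h *: (1 : R)) - f t) =
    - (h^-1 *: (f (t + h) - f t - h *: d)).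
  rewrite [h *: 1]mulr1 /= [h + t]addrC [in RHS]scalerBr scalerA mulVf//.
  by rewrite scale1r opprB.
rewrite normrN normrZ normfV ler_pdivrMl ?normr_gt0//.
apply: (le_trans (fP _ h_le1)); rewrite -real_normK ?num_real// expr2 mulrCA.
rewrite ler_wpM2l//.
apply: (@le_trans _ _ ((C + 1) * `|h|)); first by rewrite ler_wpM2r// lerDl.
by rewrite mulrC -ler_pdivlMr// ltr_wpDl.
Unshelve. all: by end_near. Qed.

(** Second-order Taylor remainder of a power, by induction on [k]. Having [M ^+ k] instead of the
    sharper power k - 1, at the price of 1 <= M, avoids a special case at k = 0. *)
Lemma norm_exprB_tangent_le (R : realDomainType) (s t M : R) (k : nat) :
  1 <= M -> `|s| <= M -> `|t| <= M ->
  `|s ^+ k.+1 - t ^+ k.+1 - (s - t) * (t ^+ k *+ k.+1)| <=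
    (k.+1 * k)%:R * M ^+ k * (s - t) ^+ 2.
Proof.
move=> M1 sM tM; have M0 : 0 <= M by exact: le_trans M1.
elim: k => [|k IH].
  by rewrite !expr1 expr0 mulr1 subrr normr0 muln0 !mul0r.
(* The remainders satisfy r_(k+1) = s r_k + (k+1) t^k (s - t)^2. *)
have -> : s ^+ k.+2 - t ^+ k.+2 - (s - t) * (t ^+ k.+1 *+ k.+2) =
    s * (s ^+ k.+1 - t ^+ k.+1 - (s - t) * (t ^+ k *+ k.+1)) +
    t ^+ k *+ k.+1 * (s - t) ^+ 2.
  rewrite -![t ^+ _ *+ _]mulr_natr -(natr1 k.+1) (exprS s k.+1) (exprS t k.+1) (exprS t k).
  by move: (s ^+ k.+1) (t ^+ k) (k.+1%:R) => u v w; ring.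
apply: (le_trans (ler_normD _ _)); rewrite (normrM s) (normrM (_ *+ _)).
have h0 : 0 <= (s - t) ^+ 2 by exact: sqr_ge0.
have Mk : M ^+ k <= M ^+ k.+1 by rewrite exprS ler_peMl// exprn_ge0.
(* From (k+2)(k+1) = (k+1)k + 2(k+1): the first part absorbs s r_k, the second exceeds what the new
   term requires by a factor 2 M. *)
have -> : (k.+2 * k.+1)%:R * M ^+ k.+1 * (s - t) ^+ 2 =
   M * ((k.+1 * k)%:R * M ^+ k * (s - t) ^+ 2) +
   (2 * k.+1)%:R * M ^+ k.+1 * (s - t) ^+ 2.
  rewrite !natrM -(natr1 k.+1) -(natr1 k) exprS.
  by move: (M ^+ k) (k%:R) => u w; ring.
apply: lerD; first exact: ler_pM.
rewrite [`|_ ^+ 2|]ger0_norm//; apply: ler_wpM2r => //.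
rewrite normrMn normrX -[leLHS]mulr_natl; apply: ler_pM => //.
- by rewrite ler_nat leq_pmull.
- by apply: le_trans Mk; rewrite lerXn2r ?nnegrE.
Qed.

Section ExpA.
Variables (R : realType) (A : realBanachAlg R).
Implicit Types (x y b c : A) (u : A ^nat).

Definition expA_coeff y : A ^nat := fun k => (k`!%:R^-1 : R) *: y ^+ k.

Lemma normA_mul x y : `|x * y| <= `|x| * `|y|.
Proof. exact: rba_norm_mul. Qed.

(* The factor [`|1|] is there for [k = 0]: the norm of the unit of A may exceed 1. *)
Lemma normA_exp y k : `|y ^+ k| <= `|1 : A| * `|y| ^+ k.
Proof.
elim: k => [|k IH]; first by rewrite !expr0 mulr1.
rewrite exprS (le_trans (normA_mul _ _))// exprS mulrCA.
by rewrite ler_wpM2l.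
Qed.

Lemma cvgA_mull x u (l : A) :
  u n @[n --> \oo] --> l -> x * u n @[n --> \oo] --> x * l.
Proof.
move=> ul; apply/cvgrPdist_le => e e0; near=> n.
rewrite -mulrBr (le_trans (normA_mul _ _))//.
have un : `|l - u n| <= e / (`|x| + 1).
  by near: n; move/cvgrPdist_le: ul; apply; rewrite divr_gt0// ltr_wpDl.
apply: (@le_trans _ _ ((`|x| + 1) * `|l - u n|)).
  by rewrite ler_wpM2r// lerDl.
by rewrite mulrC -ler_pdivlMr// ltr_wpDl.
Unshelve. all: by end_near. Qed.

Lemma cvgA_mulr x u (l : A) :
  u n @[n --> \oo] --> l -> u n * x @[n --> \oo] --> l * x.
Proof.
move=> ul; apply/cvgrPdist_le => e e0; near=> n.
rewrite -mulrBl (le_trans (normA_mul _ _))//.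
have un : `|l - u n| <= e / (`|x| + 1).
  by near: n; move/cvgrPdist_le: ul; apply; rewrite divr_gt0// ltr_wpDl.
apply: (@le_trans _ _ (`|l - u n| * (`|x| + 1))).
  by rewrite ler_wpM2l// lerDl.
by rewrite -ler_pdivlMr// ltr_wpDl.
Unshelve. all: by end_near. Qed.

(** Absolute convergence, by comparison with |1| times the real exponential series at |y|;
    completeness of [A] enters through [normed_cvg]. *)
Lemma cvg_series_expA y : series (expA_coeff y) n @[n --> \oo] --> expA y.
Proof.
apply: normed_cvg.
apply: (@series_le_cvg _ _ (fun k => `|1 : A| * exp_coeff `|y| k)) => [k|k|k|].
- exact: normr_ge0.
- by rewrite mulr_ge0 ?exp_coeff_ge0.
- rewrite /exp_coeff /= normrZ ger0_norm ?invr_ge0// mulrA [leRHS]mulrC.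
  by rewrite ler_wpM2l ?invr_ge0// normA_exp.
- exact: (is_cvg_seriesZ (V := R) (k := `|1 : A|) (is_cvg_series_exp_coeff _)).
Qed.

(** [c] commutes with every partial sum, and multiplication by [c] on either side is continuous, so
    the two limits agree. *)
Lemma expA_comm y c : c * y = y * c -> c * expA y = expA y * c.
Proof.
move=> cy.
have eq_series n : c * series (expA_coeff y) n = series (expA_coeff y) n * c.
  rewrite /series /= mulr_sumr mulr_suml; apply: eq_bigr => k _.
  rewrite /expA_coeff -scalerAr -scalerAl.
  by have /commrX -> : GRing.comm c y.
have cl := cvgA_mulr (x := c) (cvg_series_expA (y := y)).
have := cvgA_mull (x := c) (cvg_series_expA (y := y)).
under eq_cvg do rewrite eq_series.
by move=> /(cvg_unique _ cl)/esym; exact.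
Qed.

(** The lengths differ by one because the derivative of the term of degree k+1 is [b] times the term
    of degree k; the constant terms cancel. *)
Lemma series_expA_tangent b (s t : R) n :
  series (expA_coeff (s *: b)) n.+1 - series (expA_coeff (t *: b)) n.+1
    - (s - t) *: (b * series (expA_coeff (t *: b)) n) =
  \sum_(0 <= k < n) ((s ^+ k.+1 - t ^+ k.+1 - (s - t) * (t ^+ k *+ k.+1))
    / k.+1`!%:R) *: b ^+ k.+1.
Proof.
rewrite /series /= !big_nat_recl// /expA_coeff !expr0 opprD addrACA subrr add0r.
rewrite mulr_sumr scaler_sumr -!sumrB; apply: eq_bigr => k _.
rewrite !exprZn -!scalerAr -exprS !scalerA -!scalerBl; congr (_ *: _).
rewrite factS natrM -[t ^+ k *+ _]mulr_natr.
have k0 : k.+1%:R != 0 :> R by rewrite pnatr_eq0.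
have f0 : k`!%:R != 0 :> R by rewrite pnatr_eq0 -lt0n fact_gt0.
by field; rewrite f0 nat1r k0.
Qed.

Lemma expA_tangent_le b (s t M : R) :
  1 <= M -> `|s| <= M -> `|t| <= M ->
  `|expA (s *: b) - expA (t *: b) - (s - t) *: (b * expA (t *: b))| <=
    `|1 : A| * `|b| * expR (2 * M * `|b|) * (s - t) ^+ 2.
Proof.
move=> M1 sM tM; have M0 : 0 <= M by exact: le_trans M1.
set K := leRHS.
have lim_tangent : series (expA_coeff (s *: b)) n.+1
    - series (expA_coeff (t *: b)) n.+1
    - (s - t) *: (b * series (expA_coeff (t *: b)) n) @[n --> \oo] -->
    expA (s *: b) - expA (t *: b) - (s - t) *: (b * expA (t *: b)).
  apply: cvgB; first apply: cvgB.
  - by have := cvg_series_expA (y := s *: b); rewrite -cvg_shiftS.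
  - by have := cvg_series_expA (y := t *: b); rewrite -cvg_shiftS.
  - by apply: cvgZ; [exact: cvg_cst | apply: cvgA_mull; exact: cvg_series_expA].
rewrite -(cvg_lim _ (cvg_norm lim_tangent))//.
apply: limr_le; first by apply/cvg_ex; eexists; exact: cvg_norm lim_tangent.
near=> n; rewrite series_expA_tangent (le_trans (ler_norm_sum _ _ _))//.
apply: (@le_trans _ _ (`|1 : A| * `|b| * (s - t) ^+ 2 *
    series (exp_coeff (2 * M * `|b|)) n)).
  rewrite /series /= mulr_sumr; apply: ler_sum => k _.
  rewrite normrZ normrM normfV [`|_%:R|]ger0_norm//.
  apply: le_trans (ler_wpM2l _ (normA_exp b k.+1)) _ => //.
  (* Since k <= 2^k, the factor k becomes geometric and is absorbed into the argument 2 M |b| of the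
     real exponential, while k+1 cancels against (k+1)!. *)
  have q_le : `|s ^+ k.+1 - t ^+ k.+1 - (s - t) * (t ^+ k *+ k.+1)| <=
      k.+1%:R * 2 ^+ k * M ^+ k * (s - t) ^+ 2.
    apply: le_trans (norm_exprB_tangent_le k M1 sM tM) _.
    rewrite natrM ler_wpM2r ?sqr_ge0// ler_wpM2r ?exprn_ge0// ler_wpM2l//.
    by rewrite -natrX ler_nat ltnW// ltn_expl.
  have k0 : k.+1%:R != 0 :> R by rewrite pnatr_eq0.
  have f0 : k`!%:R != 0 :> R by rewrite pnatr_eq0 -lt0n fact_gt0.
  have -> : `|1 : A| * `|b| * (s - t) ^+ 2 * exp_coeff (2 * M * `|b|) k =
     k.+1%:R * 2 ^+ k * M ^+ k * (s - t) ^+ 2 / (k.+1)`!%:R *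
     (`|1 : A| * `|b| ^+ k.+1).
    rewrite /exp_coeff /= factS natrM !exprMn (exprS `|b|).
    by field; rewrite f0 nat1r k0.
  rewrite ler_wpM2r ?mulr_ge0 ?exprn_ge0// ler_wpM2r ?invr_ge0//.
rewrite /K mulrAC ler_wpM2r ?sqr_ge0// ler_wpM2l ?mulr_ge0//.
(* The terms are nonnegative, so each partial sum is at most the limit [expR (2 * M * |b|)]. *)
apply: nondecreasing_cvgn_le; last exact: is_cvg_series_exp_coeff.
apply/nondecreasing_series => k _ _; apply: exp_coeff_ge0.
by rewrite !mulr_ge0.
Unshelve. all: by end_near. Qed.

Lemma is_derive_expAM b c (t : R) :
  is_derive t 1 (fun s : R => expA (s *: b) * c) (b * expA (t *: b) * c).
Proof.
(* This bounds both |t| and |t + h| for all |h| <= 1, uniformly in [h]. *)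
pose M := `|t| + 1.
apply: (is_derive1_quadratic
  (C := `|1 : A| * `|b| * expR (2 * M * `|b|) * `|c|)) => h h1.
have M1 : 1 <= M by rewrite lerDr.
have tM : `|t| <= M by rewrite lerDl.
have sM : `|t + h| <= M by rewrite (le_trans (ler_normD _ _))// lerD2l.
have := expA_tangent_le b M1 sM tM; rewrite [t + h - t]addrAC subrr add0r => le.
rewrite scalerAl -!mulrBl (le_trans (normA_mul _ _))//.
by rewrite mulrAC ler_wpM2r.
Qed.

End ExpA.

Theorem theorem9p3p2 (R : realType) (D : completeNormedComRing R)
    (charD : ring_characteristic0 D) (A : banachAlg D) (n : nat)
    (a : 'M[A]_n) (b : A) (c : 'cV[A]_n)
    (eig_b : rc_eigenvalue a b)
    (a_notin : ~ (forall i j, centralizer b (a i j)))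
    (eig_c : rc_eigencolumn a b c)
    (c_in : forall i, centralizer b (c i 0)) :
  linear_ode_solution a
    (fun t : R => \col_(i < n) (expA (t *: b) * c i 0)).
Proof.
move=> i t.
have -> : (fun s : R => (\col_(i < n) (expA (s *: b) * c i 0)) i 0) =
    (fun s : R => expA (s *: b) * c i 0) by apply/funext => s; rewrite mxE.
(* Real scalars are central, so [c k 0] commutes with [t *: b] as it does with [b]. *)
have comm_exp k : c k 0 * expA (t *: b) = expA (t *: b) * c k 0.
  by apply: expA_comm; rewrite -scalerAr -scalerAl c_in.
have -> : \sum_(k < n) a i k * (\col_(j < n) (expA (t *: b) * c j 0)) k 0 =
    b * expA (t *: b) * c i 0.
  (* Moving the exponential to the far right makes it a common factor of the sum, which leaves row
     [i] of the eigencolumn equation. *)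
  under eq_bigr do rewrite mxE -comm_exp mulrA.
  rewrite -mulr_suml -mulrA -comm_exp mulrA; congr (_ * _).
  by have /matrixP/(_ i 0) := eig_c; rewrite !mxE.
exact: is_derive_expAM.
Qed.
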